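(* Let $m\ge1$ be an integer, $\mu>0$, let $D\subset\mathbb{R}^2$ be a compact convex domain, and let $V_1,\dots,V_N\in D$ be distinct nodes with radii of influence $R_{w_i}$ and associated triangles $\Delta_2(i)$. The bivariate Shepard-Bernoulli operator $S_{B_m}$ is an interpolation operator at $V_i$, $i=1,\dots,N$; that is, for every $f\in C^m(D)$, $$S_{B_m}[f](V_i)=f(V_i),\qquad i=1,\dots,N.$$
   Context: $C^m(D)$ is the class of functions of class $C^m$ on $D$ in the sense of Whitney (restrictions to $D$ of $C^m$ functions on $\mathbb{R}^2$). Weights. For each $i$ let $R_{w_i}>0$ and $B(V_i,R_{w_i})=\{\boldsymbol{x}\in\mathbb{R}^2:|\boldsymbol{x}-V_i|<R_{w_i}\}$; the balls are assumed to cover $D$. Put $W_{\mu,i}(\boldsymbol{x})=\left(\frac{1}{|\boldsymbol{x}-V_i|}-\frac{1}{R_{w_i}}\right)_+^{\mu}$, where $(\cdot)_+$ is the positive part, and $\widetilde W_{\mu,i}(\boldsymbol{x})=W_{\mu,i}(\boldsymbol{x})/\sum_{k=1}^N W_{\mu,k}(\boldsymbol{x})$, extended by continuity to the nodes, i.e. $\widetilde W_{\mu,i}(V_k)=\delta_{ik}$. Triangles. To each node $V_i$ is associated a non-degenerate triangle $\Delta_2(i)\subset B(V_i,R_{w_i})$ with vertices $V_i,V_{j_i},V_{k_i}$ among the nodes (assumed to exist), chosen to minimize $r_i(r_i^2S_i)$ among such triangles, where $r_i$ is the length of the longest side and $S_i$ is the reciprocal of twice the area of the triangle; ties are broken by a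 fixed enumeration. Generalized Taylor polynomial. For a non-degenerate triangle with vertices $U_1,U_2,U_3\in D$, let $A(P,Q,R)$ be the determinant of the $3\times3$ matrix with columns $(1,P)^T,(1,Q)^T,(1,R)^T$, $\lambda_2=\frac{A(U_1,\boldsymbol{x},U_3)}{A(U_1,U_2,U_3)}$, $\lambda_3=\frac{A(U_1,U_2,\boldsymbol{x})}{A(U_1,U_2,U_3)}$, $D_{ij}f=(U_i-U_j)\cdot\nabla f$, and $D_1^\beta=D_{21}^{\beta_1}D_{31}^{\beta_2}$, $D_2^\beta=D_{12}^{\beta_1}D_{32}^{\beta_2}$, $D_3^\beta=D_{13}^{\beta_1}D_{23}^{\beta_2}$. Bernoulli polynomials: $B_0(x)=1$, $B_n'(x)=nB_{n-1}(x)$, $\int_0^1B_n=0$ for $n\ge1$; $S_k(x)=B_k(x)-B_k(0)$. Then $$\begin{aligned}P_{m}^{[\Delta_2(U_1,U_2,U_3);U_1]}[f](\boldsymbol{x})=&f(U_1)+\sum_{j=1}^{m}\left(D_1^{(0,j-1)}f(U_3)-D_1^{(0,j-1)}f(U_1)\right)\frac{S_j(\lambda_2+\lambda_3)}{j!}\\&+\sum_{i=1}^{m}\sum_{j=1}^{m-i+1}\Big((-1)^{i+j}\big(D_2^{(j-1,i-1)}f(U_2)-D_2^{(j-1,i-1)}f(U_1)\big)\\&\quad+(-1)^j\big(D_3^{(j-1,i-1)}f(U_3)-D_3^{(j-1,i-1)}f(U_1)\big)\Big)\frac{(\lambda_2+\lambda_3)^{i-1}S_i\left(\frac{\lambda_2}{\lambda_2+\lambda_3}\right)}{i!}\frac{S_j(\lambda_2+\lambda_3)}{j!},\end{aligned}$$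 where the products $(\lambda_2+\lambda_3)^{i-1}S_i\left(\frac{\lambda_2}{\lambda_2+\lambda_3}\right)S_j(\lambda_2+\lambda_3)$ are understood as polynomials in $\lambda_2,\lambda_3$ also where $\lambda_2+\lambda_3=0$. Write $P_m^{\Delta_2(i)}=P_m^{[\Delta_2(V_i,V_{j_i},V_{k_i});V_i]}$. The bivariate Shepard-Bernoulli operator is $S_{B_m}[f](\boldsymbol{x})=\sum_{i=1}^N\widetilde W_{\mu,i}(\boldsymbol{x})P_m^{\Delta_2(i)}[f](\boldsymbol{x})$, $\boldsymbol{x}\in D$. *)

(* Defs.v *)
From HB Require Import structures.
From mathcomp Require Import all_boot all_order all_algebra.
From mathcomp Require Import ring.
From mathcomp Require Import all_classical all_reals all_analysis.

Set Implicit Arguments.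
Unset Strict Implicit.
Unset Printing Implicit Defensive.

Import Order.TTheory GRing.Theory Num.Theory.
Import numFieldNormedType.Exports.

Local Open Scope classical_set_scope.
Local Open Scope ring_scope.

(** * Plane geometry *)

(* The library norm on ['rV[R]_2] is the sup norm (it induces the same
   topology), hence a separate Euclidean norm. *)
Definition enorm (R : realType) (u : 'rV[R]_2) : R :=
  Num.sqrt (\sum_(k < 2) u 0 k ^+ 2).

Definition eball (R : realType) (c : 'rV[R]_2) (r : R) : set 'rV[R]_2 :=
  [set x | enorm (x - c) < r].

Definition triangle (R : realType) (P Q S : 'rV[R]_2) : set 'rV[R]_2 :=
  [set x | exists a b c : R, [/\ 0 <= a, 0 <= b, 0 <= c, a + b + c = 1 &
                                 x = a *: P + b *: Q + c *: S]].

(* Columns (1, P)^T, (1, Q)^T, (1, S)^T. *)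
Definition Adet (R : realType) (P Q S : 'rV[R]_2) : R :=
  let homog (X : 'rV[R]_2) : 'cV[R]_(1 + 2) := col_mx (const_mx 1) X^T in
  \det (\matrix_(i < 3, j < 3) (nth 0 [:: homog P; homog Q; homog S] j) i 0).

Definition nondegenerate (R : realType) (P Q S : 'rV[R]_2) : Prop :=
  Adet P Q S != 0.

Definition area (R : realType) (P Q S : 'rV[R]_2) : R := `|Adet P Q S| / 2.

Definition longest_side (R : realType) (P Q S : 'rV[R]_2) : R :=
  Num.max (enorm (P - Q)) (Num.max (enorm (P - S)) (enorm (Q - S))).

Definition inv_twice_area (R : realType) (P Q S : 'rV[R]_2) : R :=
  (2 * area P Q S)^-1.

Definition triangle_cost (R : realType) (P Q S : 'rV[R]_2) : R :=
  let r := longest_side P Q S in r * (r ^+ 2 * inv_twice_area P Q S).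

(** * Functions of class C^m *)

Definition partial (R : realType) (k : 'I_2) (f : 'rV[R]_2 -> R) :
  'rV[R]_2 -> R := fun x => 'D_(delta_mx 0 k) f x.

Fixpoint Cm (R : realType) (m : nat) (f : 'rV[R]_2 -> R) : Prop :=
  continuous f /\
  if m is n.+1 then
    forall k : 'I_2, (forall x, derivable f x (delta_mx 0 k)) /\
                     Cm n (partial k f)
  else True.

Definition Cm_extension (R : realType) (m : nat) (D : set 'rV[R]_2)
    (f : 'rV[R]_2 -> R) : set ('rV[R]_2 -> R) :=
  [set F | Cm m F /\ forall x, D x -> F x = f x].

(* [f] is of class C^m on [D]: only the values of [f] on [D] matter. *)
Definition Cm_on (R : realType) (m : nat) (D : set 'rV[R]_2)
    (f : 'rV[R]_2 -> R) : Prop :=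
  exists F, Cm_extension m D f F.

(* Derivatives on [D] of a function of class C^m on [D] are those of a C^m
   extension; [iter_dird_Cm_extension] below shows that they do not depend on
   the extension when [D] is convex with nonempty interior. *)
Definition ext (R : realType) (m : nat) (D : set 'rV[R]_2)
    (f : 'rV[R]_2 -> R) : 'rV[R]_2 -> R :=
  xget f (Cm_extension m D f).

(* u . grad f *)
Definition dird (R : realType) (u : 'rV[R]_2) (f : 'rV[R]_2 -> R) :
  'rV[R]_2 -> R := fun x => \sum_(k < 2) u 0 k * partial k f x.

(* (u . grad)^b1 (v . grad)^b2 f *)
Definition iter_dird (R : realType) (u v : 'rV[R]_2) (b1 b2 : nat)
    (f : 'rV[R]_2 -> R) : 'rV[R]_2 -> R :=
  iter b1 (dird u) (iter b2 (dird v) f).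

Lemma Cm_continuous (R : realType) n (f : 'rV[R]_2 -> R) :
  Cm n f -> continuous f.
Proof. by case: n => [|n] []. Qed.

Lemma Cm_lin (R : realType) n (a b : R) (f g : 'rV[R]_2 -> R) :
  Cm n f -> Cm n g -> Cm n (fun x => a * f x + b * g x).
Proof.
have cc (h k : 'rV[R]_2 -> R) : continuous h -> continuous k ->
    continuous (fun x => a * h x + b * k x).
  move=> ch ck x; apply: (@continuousD _ _ _ (fun y => a * h y) (fun y => b * k y)).
    by apply: (@continuousM _ _ (fun=> a) h); [exact: cst_continuous|exact: ch].
  by apply: (@continuousM _ _ (fun=> b) k); [exact: cst_continuous|exact: ck].
elim: n f g => [|n IH] f g [cf df] [cg dg]; split => //.
- exact: cc.
- exact: cc.
- move=> k; have [df1 df2] := df k; have [dg1 dg2] := dg k; split.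
    move=> x; apply: derivableD; apply: derivableM => //; exact: derivable_cst.
  rewrite (_ : partial k _ = fun x => a * partial k f x + b * partial k g x).
    exact: IH.
  apply/funext => x; rewrite /partial.
  rewrite (@deriveD _ _ _ (fun x => a * f x) (fun x => b * g x)).
  + rewrite (@deriveMl _ _ f) // (@deriveMl _ _ g) //.
  + apply: derivableM => //; exact: derivable_cst.
  + apply: derivableM => //; exact: derivable_cst.
Qed.

Lemma Cm_dird (R : realType) n (u : 'rV[R]_2) (f : 'rV[R]_2 -> R) :
  Cm n.+1 f -> Cm n (dird u f).
Proof.
move=> [_ df]; rewrite (_ : dird u f = fun x =>
  u 0 ord0 * partial ord0 f x + u 0 (lift ord0 ord0) * partial (lift ord0 ord0) f x).
  by apply: Cm_lin; [have [] := df ord0|have [] := df (lift ord0 ord0)].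
by apply/funext => x; rewrite /dird big_ord_recl big_ord1.
Qed.

Lemma Cm_iter_dird (R : realType) n b (u : 'rV[R]_2) (f : 'rV[R]_2 -> R) :
  Cm (b + n) f -> Cm n (iter b (dird u) f).
Proof.
elim: b n => [//|b IH] n Cf /=; apply: Cm_dird; apply: IH.
by rewrite addnS.
Qed.

Lemma dird_eq_on_open (R : realType) (O : set 'rV[R]_2) u (f g : 'rV[R]_2 -> R) :
  open O -> (forall x, O x -> f x = g x) ->
  forall x, O x -> dird u f x = dird u g x.
Proof.
move=> oO fg x Ox; apply: eq_bigr => k _; congr (_ * _); rewrite /partial.
apply: near_eq_derive.
by near=> y; apply: fg; near: y; exact: open_nbhs_nbhs.
Unshelve. all: by end_near. Qed.

Lemma convex_sub_closure_interior (R : realType) (D : set 'rV[R]_2) :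
  convex_set D -> D° !=set0 -> D `<=` closure D°.
Proof.
move=> cD [p Dp] x Dx B xB.
have cl : (fun t : R => x + t *: (p - x)) @ (0 : R) --> x.
  have : (fun t : R => x + t *: (p - x)) @ (0 : R) --> x + (0 : R) *: (p - x).
    by apply: cvgD; [exact: cvg_cst|apply: cvgZr_tmp; exact: cvg_id].
  by rewrite scale0r addr0.
have /(_ _ xB) := cl; move=> /nbhs_ballP[e /= e0 He].
pose t := Num.min (e / 2) 1.
have t0 : 0 < t by rewrite lt_min ltr01 divr_gt0.
have t1 : t <= 1 by rewrite ge_min lexx orbT.
exists (x + t *: (p - x)); split; last first.
  apply: He; rewrite -ball_normE /= sub0r normrN gtr0_norm //.
  by rewrite gt_min ltr_pdivrMr // ltr_pMr // ltr1n.
have cy : continuous (fun y : 'rV[R]_2 => x + t^-1 *: (y - x)).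
  move=> y; apply: (@continuousD _ _ _ (cst x)
    (fun y : 'rV[R]_2 => t^-1 *: (y - x))); first exact: cst_continuous.
  apply: (@continuousZl_tmp _ _ _ (fun y : 'rV[R]_2 => y - x)).
  by apply: (@continuousB _ _ _ id (cst x)) => //; exact: cst_continuous.
have xtp : x + t^-1 *: (x + t *: (p - x) - x) = p.
  by rewrite [x + _ - x]addrC addKr scalerA mulVf ?gt_eqF // scale1r addrC subrK.
have {}cy := cy (x + t *: (p - x)); rewrite /continuous_at xtp in cy.
move: (cy _ Dp); rewrite /interior /= => H.
have t01 : {t' : {i01 R} | t'%:num = t}.
  by exists (Itv01 (ltW t0) t1).
case: t01 => t' t'E.
suff DD : (fun y : 'rV[R]_2 => x + t^-1 *: (y - x)) @^-1` D `<=` D.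
  exact: filterS DD H.
move=> y /= Dy.
have := cD (x + t^-1 *: (y - x)) x t'.
rewrite !inE => /(_ Dy Dx); congr D.
rewrite /conv /= t'E scalerDr scalerA mulfV ?gt_eqF // scale1r /unstable.onem.
by rewrite addrAC -scalerDl addrC subrKC scale1r subrK.
Qed.

Lemma iter_dird_Cm_extension (R : realType) m (D : set 'rV[R]_2)
    (f F G : 'rV[R]_2 -> R) u v b1 b2 :
  convex_set D -> D° !=set0 -> Cm_extension m D f F -> Cm_extension m D f G ->
  (b1 + b2 <= m)%N ->
  forall x, D x -> iter_dird u v b1 b2 F x = iter_dird u v b1 b2 G x.
Proof.
move=> cD iD [CF Ff] [CG Gf] bm x Dx.
have cont H : Cm m H -> continuous (iter_dird u v b1 b2 H).
  move=> CH; apply: (@Cm_continuous _ (m - b2 - b1)).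
  apply: Cm_iter_dird; apply: Cm_iter_dird.
  by rewrite [(b1 + _)%N]subnKC ?subnKC // ?leq_subRL // (leq_trans _ bm) ?leq_addl // addnC.
have eqO y : D° y -> iter_dird u v b1 b2 F y = iter_dird u v b1 b2 G y.
  have it b w h k : (forall y, D° y -> h y = k y) ->
      forall y, D° y -> iter b (dird w) h y = iter b (dird w) k y.
    move=> hk; elim: b => //= b IH; apply: dird_eq_on_open => //.
    exact: open_interior.
  move: y; apply: (it _) => y; move: y; apply: (it _) => z /interior_subset Dz.
  by rewrite Ff // Gf.
have clE : closed [set y | iter_dird u v b1 b2 F y - iter_dird u v b1 b2 G y = 0].
  apply: (@preimage_closed _ _ (fun y => iter_dird u v b1 b2 F y - iter_dird u v b1 b2 G y)
    [set 0]); last exact: closed_eq.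
  by move=> y _; apply: continuousB; apply: cont.
apply/eqP; rewrite -subr_eq0; apply/eqP.
apply: (clE x); apply: closureS (convex_sub_closure_interior cD iD Dx).
by move=> y /eqO /= ->; exact: subrr.
Qed.

(** * Bernoulli polynomials *)

Definition primitive_poly (R : realType) (p : {poly R}) : {poly R} :=
  \poly_(i < (size p).+1) (if i is k.+1 then p`_k / k.+1%:R else 0).

Definition mean01 (R : realType) (p : {poly R}) : R :=
  (\int[lebesgue_measure]_(x in `[0, 1]) p.[x])%R.

(* [bernoulli n.+1] is the primitive of [n.+1 * bernoulli n] whose integral
   over [0, 1] vanishes: see [deriv_bernoulli] and [mean01_bernoulli]. *)
Fixpoint bernoulli (R : realType) (n : nat) : {poly R} :=
  if n is k.+1 then
    let q := primitive_poly (n%:R *: bernoulli R k) in q - (mean01 q)%:P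
  else 1.

Lemma deriv_primitive_poly (R : realType) (p : {poly R}) :
  (primitive_poly p)^`() = p.
Proof.
apply/polyP => i; rewrite coef_deriv coef_poly ltnS.
case: ltnP => [ip|pi]; last by rewrite mul0rn nth_default.
by rewrite -[LHS]mulr_natr divfK // pnatr_eq0.
Qed.

Lemma deriv_bernoulli (R : realType) n :
  (bernoulli R n.+1)^`() = n.+1%:R *: bernoulli R n.
Proof. by rewrite /= derivB derivC subr0 deriv_primitive_poly. Qed.

Lemma mean01_bernoulli (R : realType) n : mean01 (bernoulli R n.+1) = 0.
Proof.
have int (p : {poly R}) :
    (@lebesgue_measure R).-integrable `[0, 1] (EFin \o horner p).
  apply: continuous_compact_integrable; first exact: segment_compact.
  exact/continuous_subspaceT/continuous_horner.
rewrite /=; set q := primitive_poly _; set c := mean01 q.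
transitivity (\int[lebesgue_measure]_(x in `[0%R, 1%R]) (horner q x - cst c x))%R.
  by apply: eq_Rintegral => x _; rewrite hornerD hornerN hornerC.
rewrite RintegralB //=; last first.
  rewrite (_ : EFin \o _ = EFin \o horner c%:P).
    exact: int.
  by apply/funext => x /=; rewrite hornerC.
rewrite Rintegral_cst//= lebesgue_measure_itv/= lte_fin ltr01 -EFinD subr0.
by rewrite mulr1 subrr.
Qed.

Lemma size_bernoulli (R : realType) n : (size (bernoulli R n) <= n.+1)%N.
Proof.
elim: n => [|n IH] /=; first by rewrite size_poly1.
apply: (leq_trans (size_polyD _ _)); rewrite geq_max size_polyN.
rewrite (leq_trans (size_polyC_leq1 _)) // andbT.
by apply: (leq_trans (size_poly _ _)); rewrite ltnS (leq_trans (size_scale_leq _ _)).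
Qed.

Definition Sbern (R : realType) (k : nat) : {poly R} :=
  bernoulli R k - ((bernoulli R k).[0])%:P.

(* z^(i-1) S_i(l / z) S_j(z) for i, j >= 1, as a polynomial in (l, z): since
   'X divides S_j, it is (z^i S_i(l / z)) (S_j(z) / z).  See [SbernSbernE]. *)
Definition SbernSbern (R : realType) (i j : nat) (l z : R) : R :=
  (\sum_(k < i.+1) (Sbern R i)`_k * l ^+ k * z ^+ (i - k)) *
  (Sbern R j %/ 'X).[z].

Lemma size_Sbern (R : realType) n : (size (Sbern R n) <= n.+1)%N.
Proof.
apply: (leq_trans (size_polyD _ _)); rewrite geq_max size_polyN size_bernoulli.
by rewrite (leq_trans (size_polyC_leq1 _)).
Qed.

Lemma SbernSbernE (R : realType) (i j : nat) (l z : R) : (0 < i)%N -> z != 0 ->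
  SbernSbern i j l z =
  z ^+ (i - 1) * (Sbern R i).[l / z] * (Sbern R j).[z].
Proof.
move=> i0 z0; rewrite /SbernSbern.
have /(congr1 (horner^~ z)) /= : Sbern R j = (Sbern R j %/ 'X) * 'X.
  rewrite divpK // -['X]subr0 -polyC0 dvdp_XsubCl /root /Sbern.
  by rewrite hornerD hornerN hornerC subrr.
rewrite hornerMX => ->.
rewrite [_.[z] * z]mulrC mulrA; congr (_ * _).
rewrite -mulrA [_ * z]mulrC mulrA -exprSr subn1 prednK //.
rewrite (horner_coef_wide _ (size_Sbern R i)) mulr_sumr.
apply: eq_bigr => k _; rewrite exprMn exprVn.
have -> : z ^+ i = z ^+ (i - k) * z ^+ k by rewrite -exprD subnK // leq_ord.
by field; rewrite expf_neq0.
Qed.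

(** * Generalized Taylor polynomial and Shepard-Bernoulli operator *)

Definition PTaylor (R : realType) (m : nat) (D : set 'rV[R]_2)
    (f : 'rV[R]_2 -> R) (U1 U2 U3 x : 'rV[R]_2) : R :=
  let F := ext m D f in
  let l2 := Adet U1 x U3 / Adet U1 U2 U3 in
  let l3 := Adet U1 U2 x / Adet U1 U2 U3 in
  let z := l2 + l3 in
  let D1 b1 b2 := iter_dird (U2 - U1) (U3 - U1) b1 b2 F in
  let D2 b1 b2 := iter_dird (U1 - U2) (U3 - U2) b1 b2 F in
  let D3 b1 b2 := iter_dird (U1 - U3) (U2 - U3) b1 b2 F in
  f U1
  + \sum_(1 <= j < m.+1)
      (D1 0%N (j - 1)%N U3 - D1 0%N (j - 1)%N U1) * ((Sbern R j).[z] / j`!%:R)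
  + \sum_(1 <= i < m.+1) \sum_(1 <= j < (m - i + 1).+1)
      ((-1) ^+ (i + j) * (D2 (j - 1)%N (i - 1)%N U2 - D2 (j - 1)%N (i - 1)%N U1)
       + (-1) ^+ j * (D3 (j - 1)%N (i - 1)%N U3 - D3 (j - 1)%N (i - 1)%N U1))
      * (SbernSbern i j l2 z / (i`!%:R * j`!%:R)).

Definition weight (R : realType) (N : nat) (V : 'I_N -> 'rV[R]_2)
    (Rw : 'I_N -> R) (mu : R) (i : 'I_N) (x : 'rV[R]_2) : R :=
  (Num.max ((enorm (x - V i))^-1 - (Rw i)^-1) 0) `^ mu.

Definition weight_ratio (R : realType) (N : nat) (V : 'I_N -> 'rV[R]_2)
    (Rw : 'I_N -> R) (mu : R) (i : 'I_N) (x : 'rV[R]_2) : R :=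
  weight V Rw mu i x / \sum_(k < N) weight V Rw mu k x.

(* At the nodes: extension by continuity. *)
Definition normalized_weight (R : realType) (N : nat) (V : 'I_N -> 'rV[R]_2)
    (Rw : 'I_N -> R) (mu : R) (i : 'I_N) (x : 'rV[R]_2) : R :=
  if [exists k, x == V k] then lim (weight_ratio V Rw mu i y @[y --> x^'])
  else weight_ratio V Rw mu i x.

Definition admissible_triangle (R : realType) (N : nat) (V : 'I_N -> 'rV[R]_2)
    (Rw : 'I_N -> R) (i j k : 'I_N) : Prop :=
  nondegenerate (V i) (V j) (V k) /\
  triangle (V i) (V j) (V k) `<=` eball (V i) (Rw i).

Definition minimal_triangle (R : realType) (N : nat) (V : 'I_N -> 'rV[R]_2)
    (Rw : 'I_N -> R) (i j k : 'I_N) : Prop :=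
  admissible_triangle V Rw i j k /\
  forall j' k', admissible_triangle V Rw i j' k' ->
    triangle_cost (V i) (V j) (V k) <= triangle_cost (V i) (V j') (V k').

(* [rank] enumerates the triples of nodes and breaks ties. *)
Definition associated_triangle (R : realType) (N : nat) (V : 'I_N -> 'rV[R]_2)
    (Rw : 'I_N -> R) (rank : 'I_N * 'I_N * 'I_N -> nat)
    (i j k : 'I_N) : Prop :=
  minimal_triangle V Rw i j k /\
  forall j' k', minimal_triangle V Rw i j' k' ->
    (rank (i, j, k) <= rank (i, j', k'))%N.

Definition shepard_bernoulli (R : realType) (N : nat) (V : 'I_N -> 'rV[R]_2)
    (Rw : 'I_N -> R) (mu : R) (tj tk : 'I_N -> 'I_N) (m : nat)
    (D : set 'rV[R]_2) (f : 'rV[R]_2 -> R) (x : 'rV[R]_2) : R :=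
  \sum_(i < N) normalized_weight V Rw mu i x *
               PTaylor m D f (V i) (V (tj i)) (V (tk i)) x.

(* Main.v *)
Require Import Defs.
From mathcomp Require Import all_boot all_order all_algebra.
From mathcomp Require Import all_classical all_reals all_analysis.
Import Order.TTheory GRing.Theory Num.Theory.
Import numFieldNormedType.Exports.
Local Open Scope classical_set_scope.
Local Open Scope ring_scope.

(** Two facts combine.  First, each generalized Taylor polynomial interpolates
    at its base vertex: at [x = U1] both barycentric coordinates [lambda_2] and
    [lambda_3] vanish, and every other term carries a factor [S_j] or
    [z^(i-1) S_i(l / z) S_j(z)], which vanishes at the origin because
    [S_k(0) = 0] ([PTaylor_vertex]).  Second, the normalized weights satisfy
    the cardinality property at the nodes ([normalized_weight_node]): as [x]
    tends to [V_k] the weight of [V_k] blows up, since [mu > 0], while the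
    others stay bounded, the nodes being distinct; so the ratios tend to the
    Kronecker delta ([cvg_dominant_ratio]).  At a node the operator therefore
    reduces to the Taylor polynomial based at this very node. *)

(** The share of a bounded term is at most [B / w k], which tends to zero; that
    of the dominant term is one minus the shares of the others. *)
Lemma cvg_dominant_ratio (R : realType) (T : Type) (F : set_system T)
    (FF : Filter F) (I : finType) (w : I -> T -> R) (k : I) :
  (forall i x, 0 <= w i x) -> w k x @[x --> F] --> +oo ->
  (forall i, i != k -> exists B, \forall x \near F, w i x <= B) ->
  forall i, w i x / (\sum_j w j x) @[x --> F] --> ((i == k)%:R : R).
Proof.
move=> w0 wk wB.
have wk_gt0 : \forall x \near F, 0 < w k x by move/cvgryPgt : wk; apply.
have wk_le_sum x : w k x <= \sum_j w j x.
  by rewrite (bigD1 k) //= lerDl sumr_ge0.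
have bounded_ratio i : i != k -> w i x / (\sum_j w j x) @[x --> F] --> (0 : R).
  move=> /wB[B wiB].
  have BV : B * (w k x)^-1 @[x --> F] --> (0 : R).
    rewrite -(mulr0 B); apply: cvgM; first exact: cvg_cst.
    by apply/(gtr0_cvgV0 _).
  apply: (squeeze_cvgr _ (cvg_cst 0) BV); near=> x.
  have wkx : 0 < w k x by near: x.
  have sx : 0 < \sum_j w j x := lt_le_trans wkx (wk_le_sum x).
  rewrite divr_ge0 ?w0 ?(ltW sx) //=.
  apply: ler_pM => //; first by rewrite invr_ge0 ltW.
    by near: x.
  by rewrite lef_pV2 ?posrE.
move=> i; have [->|/bounded_ratio //] := eqVneq i k.
have sumr : 1 - \sum_(j | j != k) w j x / (\sum_l w l x) @[x --> F] --> (1 : R).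
  have one : 1 - \sum_(j | j != k) (0 : R) = 1 by rewrite big1 ?subr0.
  rewrite -[X in _ --> X]one; apply: cvgB; first exact: cvg_cst.
  by apply: (cvg_big (@add_continuous R^o)) => j /bounded_ratio.
apply: cvg_trans sumr; apply: near_eq_cvg; near=> x.
have wkx : 0 < w k x by near: x.
have sx : 0 < \sum_j w j x := lt_le_trans wkx (wk_le_sum x).
rewrite -mulr_suml -[1 in LHS](mulfV (lt0r_neq0 sx)) -mulrBl.
by congr (_ / _); rewrite [in LHS](bigD1 k) //= addrK.
Unshelve. all: by end_near. Qed.

Lemma enorm_continuous (R : realType) : continuous (@enorm R).
Proof.
move=> u; apply: (@continuous_comp _ _ _ (fun u : 'rV[R]_2 =>
  \sum_(k < 2) u 0 k ^+ 2) Num.sqrt); last exact: sqrt_continuous.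
apply: (continuous_big (@add_continuous R^o)) => k _ v.
apply: (@continuous_comp _ _ _ (fun u : 'rV[R]_2 => u 0 k) (fun a => a ^+ 2)).
  exact: coord_continuous.
exact: exprn_continuous.
Qed.

Lemma enorm0 (R : realType) : enorm (0 : 'rV[R]_2) = 0.
Proof. by rewrite /enorm big1 ?sqrtr0 // => k _; rewrite mxE expr0n. Qed.

Lemma enorm_gt0 (R : realType) (u : 'rV[R]_2) : u != 0 -> 0 < enorm u.
Proof.
move=> u0; rewrite sqrtr_gt0 lt_neqAle sumr_ge0 ?andbT; last first.
  by move=> k _; rewrite sqr_ge0.
apply: contra u0; rewrite eq_sym psumr_eq0; last by move=> k _; rewrite sqr_ge0.
move=> /allP u0; apply/eqP/rowP => k; rewrite mxE; apply/eqP.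
by rewrite -sqrf_eq0; apply: u0; rewrite mem_index_enum.
Qed.

Lemma enorm_sub_continuous (R : realType) (c : 'rV[R]_2) :
  continuous (fun x : 'rV[R]_2 => enorm (x - c)).
Proof.
move=> x; apply: (@continuous_comp _ _ _ (fun x : 'rV[R]_2 => x - c) (@enorm R)).
  by apply: (@continuousB _ _ _ id (cst c)) => //; exact: cst_continuous.
exact: enorm_continuous.
Qed.

(** The plane has no isolated point: approach [x] along a line. *)
Lemma Proper_dnbhs_plane (R : realType) (x : 'rV[R]_2) : ProperFilter x^'.
Proof.
apply: Build_ProperFilter_ex => A Ax.
pose d : 'rV[R]_2 := const_mx 1.
have dn0 : d != 0.
  by apply/eqP => /rowP/(_ 0)/eqP; rewrite !mxE oner_eq0.
have line : x + t *: d @[t --> (0 : R)] --> x.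
  rewrite -[X in _ --> X]addr0 -(scale0r d).
  by apply: cvgD; [exact: cvg_cst|apply: cvgZr_tmp; exact: cvg_id].
have line_A : \forall t \near (0 : R)^', A (x + t *: d).
  move: (nbhs_dnbhs (line _ Ax)).
  have := @nbhs_dnbhs_neq R 0; apply: filterS2 => t t0 /=; apply.
  by rewrite -subr_eq0 addrAC subrr add0r scaler_eq0 negb_or t0.
by have [t] := filter_ex line_A; exists (x + t *: d).
Qed.

Lemma weight_ge0 (R : realType) (N : nat) (V : 'I_N -> 'rV[R]_2)
    (Rw : 'I_N -> R) (mu : R) (i : 'I_N) x : 0 <= weight V Rw mu i x.
Proof. exact: powR_ge0. Qed.

(** To get [weight >= A] it suffices that [1 / |x - V_k|] exceed
    [1 / R_k + |A|^(1 / mu)]: solve for the distance. *)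
Lemma weight_cvgy (R : realType) (N : nat) (V : 'I_N -> 'rV[R]_2)
    (Rw : 'I_N -> R) (mu : R) (k : 'I_N) : 0 < mu -> 0 < Rw k ->
  weight V Rw mu k x @[x --> (V k)^'] --> +oo.
Proof.
move=> mu0 Rk0; apply/cvgryPge => A.
pose M := `|A| `^ mu^-1.
have M0 : 0 <= M by exact: powR_ge0.
have MR : 0 < M + (Rw k)^-1 by rewrite ltr_wpDl // invr_gt0.
near=> x.
have xk : x != V k by near: x; exact: nbhs_dnbhs_neq.
have xk0 : 0 < enorm (x - V k) by rewrite enorm_gt0 // subr_eq0.
have xlt : enorm (x - V k) < (M + (Rw k)^-1)^-1.
  near: x; apply: nbhs_dnbhs; apply: cvgr_lt (enorm_sub_continuous _ _ _) _ _.
  by rewrite subrr enorm0 invr_gt0.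
have Mx : M <= Num.max ((enorm (x - V k))^-1 - (Rw k)^-1) 0.
  rewrite le_max lerBrDr -[leLHS]invrK lef_pV2 ?posrE ?invr_gt0 //.
  by rewrite (ltW xlt).
apply: (le_trans (ler_norm A)).
have -> : `|A| = M `^ mu by rewrite /M -powRrM mulVf ?gt_eqF // powRr1.
apply: ge0_ler_powR; rewrite ?nnegrE //; first exact: ltW.
exact: le_trans Mx.
Unshelve. all: by end_near. Qed.

(** Points near [a] stay at distance at least [|a - V_i| / 2] from the pole
    [V_i] of the weight. *)
Lemma weight_bounded_near (R : realType) (N : nat) (V : 'I_N -> 'rV[R]_2)
    (Rw : 'I_N -> R) (mu : R) (i : 'I_N) (a : 'rV[R]_2) :
  0 < mu -> 0 < Rw i -> a != V i ->
  exists B, \forall x \near a^', weight V Rw mu i x <= B.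
Proof.
move=> mu0 Ri0 ai; pose r := enorm (a - V i) / 2.
have r0 : 0 < r by rewrite divr_gt0 // enorm_gt0 // subr_eq0.
exists (r^-1 `^ mu); near=> x.
have rx : r < enorm (x - V i).
  near: x; apply: nbhs_dnbhs; apply: cvgr_gt (enorm_sub_continuous _ _ _) _ _.
  by rewrite /r ltr_pdivrMr // ltr_pMr ?ltr1n // enorm_gt0 // subr_eq0.
apply: ge0_ler_powR; rewrite ?nnegrE.
- exact: ltW.
- by rewrite le_max lexx orbT.
- by rewrite invr_ge0 ltW.
- rewrite ge_max invr_ge0 (ltW r0) andbT.
  rewrite (@le_trans _ _ (enorm (x - V i))^-1) //.
    by rewrite gerBl invr_ge0 ltW.
  by rewrite lef_pV2 ?posrE // ?(lt_trans r0) // ltW.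
Unshelve. all: by end_near. Qed.

Lemma normalized_weight_node (R : realType) (N : nat) (V : 'I_N -> 'rV[R]_2)
    (Rw : 'I_N -> R) (mu : R) (i k : 'I_N) :
  injective V -> (forall i, 0 < Rw i) -> 0 < mu ->
  normalized_weight V Rw mu i (V k) = (i == k)%:R.
Proof.
move=> V_inj Rw_gt0 mu_gt0; rewrite /normalized_weight.
have -> : [exists l, V k == V l] by apply/existsP; exists k.
have FF := Proper_dnbhs_plane R (V k).
apply: cvg_lim; first exact: Rhausdorff.
apply: cvg_dominant_ratio.
- by move=> j x; exact: weight_ge0.
- exact: weight_cvgy.
- move=> j jk; apply: weight_bounded_near => //.
  by rewrite (inj_eq V_inj) eq_sym.
Qed.

Lemma Adet_eq12 (R : realType) (P S : 'rV[R]_2) : Adet P P S = 0.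
Proof.
rewrite /Adet -det_tr.
apply: (@determinant_alternate _ _ _ ord0 (lift ord0 ord0)) => // j.
by rewrite !mxE.
Qed.

Lemma Adet_eq13 (R : realType) (P Q : 'rV[R]_2) : Adet P Q P = 0.
Proof.
rewrite /Adet -det_tr.
apply: (@determinant_alternate _ _ _ ord0 ord_max) => // j.
by rewrite !mxE.
Qed.

Lemma Sbern_at0 (R : realType) k : (Sbern R k).[0] = 0.
Proof. by rewrite /Sbern hornerD hornerN hornerC subrr. Qed.

(** The first factor is homogeneous of degree [i] in [(l, z)], and its only
    possibly nonvanishing monomial when [l = 0], namely [z ^ i], has coefficient
    [S_i(0) = 0]. *)
Lemma SbernSbern_l0 (R : realType) i j (z : R) : SbernSbern i j 0 z = 0.
Proof.
rewrite /SbernSbern big_ord_recl big1 => [|k _].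
  by rewrite -horner_coef0 Sbern_at0 !mul0r addr0 mul0r.
by rewrite expr0n mulr0 mul0r.
Qed.

Lemma PTaylor_vertex (R : realType) (m : nat) (D : set 'rV[R]_2)
    (f : 'rV[R]_2 -> R) (U1 U2 U3 : 'rV[R]_2) :
  PTaylor m D f U1 U2 U3 U1 = f U1.
Proof.
rewrite /PTaylor Adet_eq12 Adet_eq13 !mul0r addr0.
rewrite big1 ?addr0; last by move=> j _; rewrite Sbern_at0 mul0r mulr0.
rewrite big1 ?addr0 // => i _; rewrite big1 // => j _.
by rewrite SbernSbern_l0 mul0r mulr0.
Qed.

Theorem theorem3p2 (R : realType) (m : nat) (m_ge1 : (1 <= m)%N)
  (mu : R) (mu_gt0 : 0 < mu)
  (D : set 'rV[R]_2) (D_compact : compact D) (D_convex : convex_set D)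
  (D_interior : D° !=set0)
  (N : nat) (V : 'I_N -> 'rV[R]_2) (V_inj : injective V)
  (V_in_D : forall i, D (V i))
  (Rw : 'I_N -> R) (Rw_gt0 : forall i, 0 < Rw i)
  (balls_cover : D `<=` \bigcup_(i in [set: 'I_N]) eball (V i) (Rw i))
  (rank : 'I_N * 'I_N * 'I_N -> nat) (rank_inj : injective rank)
  (tj tk : 'I_N -> 'I_N)
  (tjk : forall i, associated_triangle V Rw rank i (tj i) (tk i)) :
  forall f : 'rV[R]_2 -> R, Cm_on m D f ->
  forall i : 'I_N, shepard_bernoulli V Rw mu tj tk m D f (V i) = f (V i).
Proof.
move=> f _ i; rewrite /shepard_bernoulli (bigD1 i) //= big1 => [|k ki].
  by rewrite normalized_weight_node // eqxx mul1r PTaylor_vertex addr0.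
by rewrite normalized_weight_node // (negbTE ki) mul0r.
Qed.
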